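(* Let $P\ge 1$, $M\ge 1$ and $1\le L\le M$ be integers, and consider the cooperative coupon game with $P$ players, $M$ labels and lots of $L$ coupons drawn uniformly (continue-on-completion or exit-on-completion). Let $T$ be the $(\mu_P(M)-1)\times(\mu_P(M)-1)$ matrix, with rows and columns indexed by $\{0,\dots,\mu_P(M)-2\}$, such that for all states $S',S''\neq(M,0,\dots,0)$ $$T_{Q_P(S''),Q_P(S')}=\phi(S'',S')\binom{M}{L}^{-1}\prod_{k=0}^P\binom{S'_k}{W_k(S''-S')},$$ and define numbers $\tau_j$ by $\tau_0=1$ and $$\tau_j=\frac{1}{1-T_{j,j}}\sum_{k=0}^{j-1}T_{j,k}\,\tau_k\qquad\text{for } j=1,\dots,\mu_P(M)-2.$$ Then the average number of bursts needed to reach the common goal is $$\mathcal{B}^{\mathbf{goal}}=\sum_{j=0}^{\mu_P(M)-2}\tau_j.$$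
   Context: The game. $P$ players collect coupons, each carrying one of $M$ labels; initially nobody has a coupon. Each player's local goal is to own one coupon of every label; the common goal is that all players reach their local goal. The game proceeds in bursts. In each burst a lot of $L$ coupons with pairwise different labels enters the system; lots are drawn independently, each uniformly among the $\binom{M}{L}$ possible $L$-subsets of labels. The whole lot is assigned to one active player, selected independently and uniformly among the active players. That player retains the coupons of the lot whose labels she misses and offers every other coupon of the lot to the other active players. Each active player missing the label of an offered coupon requests it. If there is at least one request, the coupon is assigned uniformly at random (independently for different coupons) to one of the requesting players and transferred to her; if there is no request it is discarded. No new burst is started once the common goal has been achieved. In the continue-on-completion game all players remain active until the common goal is reached; in the exit-on-completion game players exit (become inactive) at the end of the burst in which they complete their collections. $\mathcal{B}^{\mathbf{goal}}$ is the expected number of bursts until the common goal is reached. States. A state is an integer tuple $S=(S_P,\dots,S_0)$ with $S_j\ge 0$ and $\sum_{j=0}^P S_j=M$; in the game, $S_j$ is the number of labels for which exactly $j$ players own a coupon. The initial state is $(0,\dots,0,M)$ and the final state is $\mathbf{goal}=(M,0,\dots,0)$. Indexing. $\mu_p(m)=\binom{m+p}{p}$ for integers $p\ge 1$, $m\ge -1$ (so $\mu_p(-1)=0$); $\mu_P(M)$ is the number of states. The index of a state is $$Q_P(S)=Q_P(S_P,\dots,S_1)=\sum_{j=0}^{P-1}\mu_{P-j}\Big(\sum_{k=j+1}^P S_k-1\Big),$$ which is a bijection from the states different from $\mathbf{goal}$ onto $\{0,\dots,\mu_P(M)-2\}$. For states $S',S''$, put $$W_k(S''-S')=\sum_{j=k+1}^P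 (S''_j-S'_j)\ \ (0\le k<P),\qquad W_P(S''-S')=L-\sum_{j=1}^P j\,(S''_j-S'_j).$$ $\phi(S'',S')=1$ if $0\le W_k(S''-S')\le\min\{L,S'_k\}$ for all $0\le k\le P$, and $\phi(S'',S')=0$ otherwise (in which case the corresponding entry of $T$ is $0$). *)

(* Defs.v *)
From mathcomp Require Import all_boot all_order all_algebra.
From mathcomp Require Import all_classical all_reals all_analysis.

Set Implicit Arguments.
Unset Strict Implicit.
Unset Printing Implicit Defensive.

Import Order.TTheory GRing.Theory Num.Theory.

Local Open Scope classical_set_scope.
Local Open Scope ring_scope.

Variant completion_rule := ContinueOnCompletion | ExitOnCompletion.

(* The labels owned by each player.  Surplus coupons are never kept, so a set
   of labels records a collection completely. *)
Definition holdings (P M : nat) := {ffun 'I_P -> {set 'I_M}}.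

Definition no_coupons (P M : nat) : holdings P M := [ffun=> finset.set0].

Definition all_complete (P M : nat) : holdings P M := [ffun=> finset.setT].

(* (lot, player the lot is assigned to, recipient of each transferred coupon).
   The recipient is None for a label that is not in the lot, or whose coupon is
   retained or discarded. *)
Definition burst (P M : nat) :=
  ({set 'I_M} * 'I_P * {ffun 'I_M -> option 'I_P})%type.

Definition unif (R : realType) (A : finType) (X : {set A}) (x : A) : R :=
  if x \in X then #|X|%:R^-1 else 0.

Section Game.
Variables (R : realType) (P M L : nat) (rule : completion_rule).
Implicit Types (G : holdings P M) (a : 'I_P) (c : 'I_M).

Definition active G : {set 'I_P} :=
  match rule with
  | ContinueOnCompletion => finset.setT
  | ExitOnCompletion => [set q | G q != finset.setT]%SET
  end.

Definition offered G (lot : {set 'I_M}) a : {set 'I_M} := (lot :&: G a)%SET.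

Definition requesters G a c : {set 'I_P} :=
  [set q in active G | (q != a) && (c \notin G q)]%SET.

Definition recipient_law G (lot : {set 'I_M}) a c (r : option 'I_P) : R :=
  if (c \in offered G lot a) && (requesters G a c != finset.set0) then
    if r is Some q then unif R (requesters G a c) q else 0
  else (r == None)%:R.

(* Conditional law of the next burst given the holdings; None means that no
   burst is started. *)
Definition burst_law G (ob : option (burst P M)) : R :=
  if G == all_complete P M then (if ob is None then 1 else 0)
  else if ob is Some (lot, a, recipient) then
    unif R [set A : {set 'I_M} | #|A| == L]%SET lot
    * unif R (active G) a
    * \prod_c recipient_law G lot a c (recipient c)
  else 0.

Definition play G (ob : option (burst P M)) : holdings P M :=
  if ob is Some (lot, a, recipient) then
    [ffun q => (G q :|: (if q == a then lot else finset.set0)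
                    :|: [set c | recipient c == Some q])%SET]
  else G.

Fixpoint holdings_after (h : nat -> option (burst P M)) (n : nat) :
    holdings P M :=
  if n is n'.+1 then play (holdings_after h n') (h n') else no_coupons P M.

(* burst_seq n w is the burst number n (from 0) in the outcome w.  The second
   clause is the chain rule: given any past, the next burst has the law
   prescribed by the current holdings. *)
Definition is_game d (Omega : measurableType d) (Pr : probability Omega R)
    (burst_seq : nat -> Omega -> option (burst P M)) : Prop :=
  (forall n ob, measurable [set w | burst_seq n w = ob]) /\
  (forall (n : nat) (h : nat -> option (burst P M)),
     (Pr [set w | forall i, (i < n.+1)%N -> burst_seq i w = h i]
      = Pr [set w | forall i, (i < n)%N -> burst_seq i w = h i]
        * (burst_law (holdings_after h n) (h n))%:E)%E).

(* First time at which the common goal holds; +oo if it is never reached. *)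
Definition bursts_to_goal (h : nat -> option (burst P M)) : \bar R :=
  ereal_inf [set (n%:R)%:E | n in
    [set n : nat | holdings_after h n = all_complete P M]].

Definition expected_bursts d (Omega : measurableType d)
    (Pr : probability Omega R)
    (burst_seq : nat -> Omega -> option (burst P M)) : \bar R :=
  (\int[Pr]_w bursts_to_goal (fun n => burst_seq n w))%E.

End Game.

(* S j is the component S_j. *)
Definition is_state (P M : nat) (S : {ffun 'I_P.+1 -> nat}) : Prop :=
  (\sum_j S j)%N = M.

Definition goal_state (P M : nat) : {ffun 'I_P.+1 -> nat} :=
  [ffun j => if j == ord_max then M else 0%N].

(* Meant for 1 <= p and -1 <= m, where m + p is nonnegative and the absolute
   value is only a cast to nat. *)
Definition mu (p : nat) (m : int) : nat := 'C(`|(m + p%:Z)%R|%N, p).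

Definition Q (P : nat) (S : {ffun 'I_P.+1 -> nat}) : nat :=
  (\sum_(j < P)
     mu (P - j) ((\sum_(k < P.+1 | (j < k)%N) (S k)%:Z) - 1)%R)%N.

(* W L S'' S' k is W_k(S'' - S'). *)
Definition W (P L : nat) (S'' S' : {ffun 'I_P.+1 -> nat}) (k : 'I_P.+1) : int :=
  if (k < P)%N then \sum_(j < P.+1 | (k < j)%N) ((S'' j)%:Z - (S' j)%:Z)
  else L%:Z - \sum_(j < P.+1 | (1 <= j)%N) j%:Z * ((S'' j)%:Z - (S' j)%:Z).

Definition phi (P L : nat) (S'' S' : {ffun 'I_P.+1 -> nat}) : bool :=
  [forall k : 'I_P.+1, 0 <= W L S'' S' k <= (minn L (S' k))%:Z].

(* The absolute value only matters when phi holds, where W is nonnegative. *)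
Definition T_entry (R : realType) (P M L : nat)
    (S'' S' : {ffun 'I_P.+1 -> nat}) : R :=
  (phi L S'' S')%:R * 'C(M, L)%:R^-1
  * \prod_(k < P.+1) 'C(S' k, `|W L S'' S' k|%N)%:R.

(* Main.v *)
(* The number of owners of a label in the lot increases by one, unless all the
   players already own it, whoever the lot is assigned to: an active player who
   misses an offered label exists as soon as some player misses it, since
   complete players miss nothing.  Hence the state is a Markov chain whose
   transition probabilities are multivariate hypergeometric, under both
   completion rules.  The index Q of a state is its rank in the combinatorial
   number system of the tail sums S_P + ... + S_k; these never decrease, so T is
   lower triangular.  The expected number of bursts is the sum over n of the
   probability that the goal is not reached after n bursts, that is, the sum of
   the expected numbers of visits to the other states, and forward substitution
   in the triangular system satisfied by these numbers gives tau. *)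

Require Import Defs.
From mathcomp Require Import all_boot all_order all_algebra.
From mathcomp Require Import all_classical all_reals all_analysis.
From mathcomp Require Import measurable_realfun zify lra.

Set Implicit Arguments.
Unset Strict Implicit.
Unset Printing Implicit Defensive.

Import Order.TTheory GRing.Theory Num.Theory.
Import numFieldNormedType.Exports.

Local Open Scope ring_scope.

(** * The combinatorial number system *)

(** For nondecreasing [v] the numbers [v p + p] strictly increase, and the sum is the rank of the
    set they form in the combinatorial number system of degree [n]. *)
Definition combinadic (n : nat) (v : nat -> nat) : nat :=
  (\sum_(p < n) 'C(v p + p, p.+1))%N.

Lemma combinadicS n v :
  combinadic n.+1 v = (combinadic n v + 'C(v n + n, n.+1))%N.
Proof. by rewrite /combinadic big_ord_recr. Qed.

Lemma eq_combinadic n u v :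
  (forall p, (p < n)%N -> u p = v p) -> combinadic n u = combinadic n v.
Proof. by move=> uv; apply: eq_bigr => i _; rewrite uv. Qed.

Lemma leq_combinadic n u v :
  (forall p, (p < n)%N -> (u p <= v p)%N) ->
  (combinadic n u <= combinadic n v)%N.
Proof.
move=> uv; apply: leq_sum => i _; apply: leq_bin2l.
by rewrite leq_add2r uv.
Qed.

(** Hockey-stick identity. The constant sequence dominates all sequences bounded by [m], so this
    yields the exact upper bound on their ranks. *)
Lemma combinadic_const n m : (combinadic n (fun=> m)).+1 = 'C(m + n, n).
Proof.
elim: n => [|n IHn]; first by rewrite /combinadic big_ord0 addn0 bin0.
by rewrite combinadicS -addSn IHn addnS binS addnC.
Qed.

Lemma combinadic_bound n m v :
  (forall p, (p < n)%N -> (v p <= m)%N) -> (combinadic n v < 'C(m + n, n))%N.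
Proof. by move=> vm; rewrite -combinadic_const ltnS; apply: leq_combinadic. Qed.

(** The top entry dominates: if [u k < v k], all of [u] up to [k] contributes less than
    ['C(u k + k.+1, k.+1)], which is at most the top term of [v]. So equal ranks have equal top
    entries, and induction handles the rest. *)
Lemma combinadic_inj n u v :
    {homo u : p q / (p <= q)%N} -> {homo v : p q / (p <= q)%N} ->
  combinadic n u = combinadic n v -> forall p, (p < n)%N -> u p = v p.
Proof.
move=> u_mono v_mono.
have lt_top u' v' k : {homo u' : p q / (p <= q)%N} -> (u' k < v' k)%N ->
    (combinadic k.+1 u' < combinadic k.+1 v')%N.
  move=> u'_mono lt_uv.
  have u'_le p : (p < k.+1)%N -> (u' p <= u' k)%N by rewrite ltnS => /u'_mono.
  apply: leq_trans (combinadic_bound u'_le) _.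
  rewrite combinadicS; apply: leq_trans (leq_addl _ _).
  by apply: leq_bin2l; rewrite addnS -addSn leq_add2r.
elim: n => [|n IHn] // uv.
have un : u n = v n.
  case: (ltngtP (u n) (v n)) => //
    [/(lt_top _ _ _ u_mono)|/(lt_top _ _ _ v_mono)]; by rewrite uv ltnn.
move: uv; rewrite !combinadicS un => /addIn/IHn IH p.
by rewrite ltnS leq_eqVlt => /predU1P[->|/IH].
Qed.

(** Pascal's rule splits the range of ranks into those with entries at most [m] and those with top
    entry [m.+1]. *)
Lemma combinadic_surj n m i : (i < 'C(m + n, n))%N ->
  exists v, [/\ {homo v : p q / (p <= q)%N}, forall p, (v p <= m)%N
            & combinadic n v = i].
Proof.
elim: n m i => [|n IHn] m i.
  rewrite addn0 bin0 ltnS leqn0 => /eqP ->.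
  by exists (fun=> m); split=> //; rewrite /combinadic big_ord0.
elim: m i => [|m IHm] i.
  rewrite add0n binn ltnS leqn0 => /eqP ->.
  exists (fun=> 0%N); split=> //; apply/eqP.
  by rewrite -eqSS combinadic_const add0n binn.
rewrite addnS binS => lt_i.
have [lt_i'|ge_i] := ltnP i 'C(m.+1 + n, n.+1).
  have [|v [v_mono v_le v_i]] := IHm i; first by rewrite addnS -addSn.
  by exists v; split=> // p; apply: leqW.
have [|v [v_mono v_le v_i]] := IHn m.+1 (i - 'C(m.+1 + n, n.+1))%N.
  by rewrite ltn_subLR.
(* The value [m.+1] sits at position [n] and is repeated beyond it, so that monotonicity and the
   bound hold at all positions. *)
exists (fun p => if (p < n)%N then v p else m.+1); split=> [p q le_pq|p|].
- case: (ltnP q n) => [lt_q|_]; last by case: ifP.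
  by rewrite (leq_ltn_trans le_pq lt_q) v_mono.
- by case: ifP.
- rewrite combinadicS ltnn -[RHS](subnK ge_i) -v_i; congr (_ + _)%N.
  by apply: eq_combinadic => p ->.
Qed.

(** * States and their indices *)

(** Tail sums, in the game the number of labels with at least [k] owners. In these coordinates [Q]
    is a rank and the chain is monotone. *)
Definition upper (P : nat) (S : {ffun 'I_P.+1 -> nat}) (k : nat) : nat :=
  (\sum_(j < P.+1 | (k <= j)%N) S j)%N.

Lemma upper0 P S : upper S 0 = (\sum_(j < P.+1) S j)%N.
Proof. by apply: eq_bigl. Qed.

Lemma upper_out P (S : {ffun 'I_P.+1 -> nat}) k : (P < k)%N -> upper S k = 0%N.
Proof.
by move=> ltPk; apply: big_pred0 => j; apply/negbTE; rewrite -ltnNge;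
  apply: leq_trans ltPk.
Qed.

Lemma upperS P (S : {ffun 'I_P.+1 -> nat}) (j : 'I_P.+1) :
  upper S j = (S j + upper S j.+1)%N.
Proof.
rewrite /upper (bigD1 j) //=; congr (_ + _)%N; apply: eq_bigl => i.
by rewrite ltn_neqAle eq_sym andbC.
Qed.

Lemma upper_anti P (S : {ffun 'I_P.+1 -> nat}) j k :
  (j <= k)%N -> (upper S k <= upper S j)%N.
Proof.
move=> le_jk; rewrite /upper [leqRHS](bigID (fun i : 'I_P.+1 => k <= i)%N) /=.
apply: leq_trans (leq_addr _ _); apply: eq_leq; apply: eq_bigl => i.
by case: (leqP k i) => [/(leq_trans le_jk) ->|]; rewrite ?andbF.
Qed.

Lemma state_ext P M (S S' : {ffun 'I_P.+1 -> nat}) :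
    is_state M S -> is_state M S' ->
  (forall k, (k < P)%N -> upper S k.+1 = upper S' k.+1) -> S = S'.
Proof.
move=> SM S'M eqU.
have {}eqU k : upper S k = upper S' k.
  case: k => [|k]; first by rewrite !upper0 SM S'M.
  by case: (ltnP k P) => [/eqU|leP] //; rewrite !upper_out.
apply/ffunP => j; apply/eqP.
by rewrite -(eqn_add2r (upper S j.+1)) {2}eqU -!upperS eqU.
Qed.

(** Tail sums decrease with the threshold, so reading them from [P] downwards gives a nondecreasing
    sequence; the shift by -1 in [mu] is absorbed by the binomial's top argument. *)
Lemma Q_combinadic P (S : {ffun 'I_P.+1 -> nat}) :
  Q S = combinadic P (fun p => upper S (P - p)).
Proof.
rewrite /Q /combinadic (reindex_inj rev_ord_inj) /=.
apply: eq_bigr => p _.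
have eP : (P - (P - p.+1))%N = p.+1 by rewrite subKn.
rewrite /mu eP; congr 'C(_, _).
have -> : (P - p = (P - p.+1).+1)%N by rewrite subnSK.
rewrite -(big_morph Posz PoszD (erefl _)) -/(upper _ _); lia.
Qed.

Lemma mu_bin P M : mu P M%:Z = 'C(M + P, P).
Proof. by rewrite /mu -PoszD. Qed.

Lemma upper_le P M (S : {ffun 'I_P.+1 -> nat}) k :
  is_state M S -> (upper S k <= M)%N.
Proof. by move=> <-; rewrite -(upper0 S) upper_anti. Qed.

Lemma Q_inj P M (S S' : {ffun 'I_P.+1 -> nat}) :
  is_state M S -> is_state M S' -> Q S = Q S' -> S = S'.
Proof.
move=> SM S'M; rewrite !Q_combinadic => eqQ.
apply: (state_ext SM S'M) => k ltkP.
have up_mono S0 : {homo (fun p => @upper P S0 (P - p)) : p q / (p <= q)%N}.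
  by move=> p q le_pq; apply: upper_anti; apply: leq_sub2l.
have /= := combinadic_inj (up_mono S) (up_mono S') eqQ (_ : P - k.+1 < P)%N.
by rewrite subKn // => -> //; lia.
Qed.

Lemma goal_is_state P M : is_state M (goal_state P M).
Proof.
rewrite /is_state (bigD1 ord_max) //= ffunE eqxx big1 ?addn0 // => j.
by rewrite ffunE => /negbTE ->.
Qed.

Lemma upper_goal P M k : (k <= P)%N -> upper (goal_state P M) k = M.
Proof.
move=> lekP; rewrite /upper (bigD1 ord_max) //= ffunE eqxx big1 ?addn0 //.
by move=> j /andP[_]; rewrite ffunE => /negbTE ->.
Qed.

Lemma Q_goal P M : Q (goal_state P M) = (mu P M%:Z - 1)%N.
Proof.
rewrite mu_bin -combinadic_const subn1 /= Q_combinadic.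
by apply: eq_combinadic => p _; rewrite upper_goal ?leq_subr.
Qed.

Lemma Q_lt P M (S : {ffun 'I_P.+1 -> nat}) :
  is_state M S -> S <> goal_state P M -> (Q S < mu P M%:Z - 1)%N.
Proof.
move=> SM Sgoal; rewrite -Q_goal ltn_neqAle; apply/andP; split.
  by apply/eqP => /(Q_inj SM (goal_is_state _ _)).
rewrite Q_goal mu_bin -combinadic_const subn1 /= Q_combinadic.
by apply: leq_combinadic => p _; apply: upper_le.
Qed.

Lemma Q_surj P M i : (i < mu P M%:Z - 1)%N ->
  exists S : {ffun 'I_P.+1 -> nat},
    [/\ is_state M S, S <> goal_state P M & Q S = i].
Proof.
move=> lti.
have [|v [v_mono v_le v_i]] := @combinadic_surj P M i.
  by rewrite mu_bin in lti; lia.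
(* The intended tail sums: [M] at 0, the sequence [v] reversed on 1 to [P], and 0 beyond. The state
   consists of their successive differences. *)
pose u k := if (k <= P)%N then if k is 0 then M else v (P - k)%N else 0%N.
have u_anti k : (u k.+1 <= u k)%N.
  rewrite /u; case: (ltnP k P) => // ltk; rewrite (ltnW ltk).
  by case: k ltk => // k ltk; apply/v_mono/leq_sub2l.
pose S := [ffun j : 'I_P.+1 => (u j - u j.+1)%N].
have upS k : (k <= P.+1)%N -> upper S k = u k.
  move=> lek; have [d dE] : exists d, (k + d = P.+1)%N.
    by exists (P.+1 - k)%N; lia.
  elim: d k dE {lek} => [|d IHd] k dE.
    by rewrite /u upper_out; [case: ifP => //; lia|lia].
  have ltk : (k < P.+1)%N by lia.
  rewrite (upperS S (Ordinal ltk)) IHd ?ffunE /=; last by lia.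
  by rewrite subnK.
have SM : is_state M S by rewrite /is_state -upper0 upS.
have QS : Q S = i.
  rewrite Q_combinadic -v_i; apply: eq_combinadic => p ltp.
  rewrite upS /u ?leq_subr; last by lia.
  by case E: (P - p)%N => [|k]; [lia|congr v; lia].
exists S; split=> // Sgoal; move: lti.
by rewrite -QS Sgoal Q_goal ltnn.
Qed.

(** * The matrix entries *)

Lemma W_upper P L (S'' S' : {ffun 'I_P.+1 -> nat}) (k : 'I_P.+1) :
  (k < P)%N -> W L S'' S' k = (upper S'' k.+1)%:Z - (upper S' k.+1)%:Z.
Proof.
by move=> ltkP; rewrite /W ltkP sumrB -!(big_morph Posz PoszD (erefl _)).
Qed.

(** In the weighted sum each difference [S'' j - S' j] has weight [j], once for each [k < j]; so
    exchanging summations shows that all the [W] together sum to [L]. *)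
Lemma W_last P L (S'' S' : {ffun 'I_P.+1 -> nat}) :
  W L S'' S' ord_max = L%:Z - \sum_(k < P) W L S'' S' (widen_ord (leqnSn P) k).
Proof.
rewrite {1}/W ltnn; congr (_ - _).
under [RHS]eq_bigr => k _ do rewrite /W /= ltn_ord big_mkcond.
rewrite exchange_big /= big_mkcond /=; apply: eq_bigr => j _.
have lejP : (j <= P)%N by rewrite -ltnS.
rewrite -big_mkcond -(big_ord_widen P (fun=> (S'' j)%:Z - (S' j)%:Z) lejP).
rewrite sumr_const card_ord -[RHS]mulr_natl natz.
by case: ifP => //; rewrite lt0n => /negbFE/eqP ->; rewrite mul0r.
Qed.

(** Nonnegativity of [W] below [P] says that no tail sum decreases, and the rank is monotone in the
    tail sums. *)
Lemma Q_phi_le P L (S'' S' : {ffun 'I_P.+1 -> nat}) :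
  phi L S'' S' -> (Q S' <= Q S'')%N.
Proof.
move=> /forallP phiW; rewrite !Q_combinadic.
apply: leq_combinadic => p ltp.
have ltk : (P - p.+1 < P.+1)%N by lia.
have := phiW (Ordinal ltk); rewrite W_upper /= ?subnSK //; last by lia.
by move=> /andP[]; rewrite subr_ge0 lez_nat.
Qed.

Lemma T_entry_ge0 (R : realType) P M L (S'' S' : {ffun 'I_P.+1 -> nat}) :
  0 <= T_entry R M L S'' S'.
Proof.
by rewrite /T_entry !mulr_ge0 ?invr_ge0 ?ler0n // prodr_ge0.
Qed.

Lemma T_entry_lower (R : realType) P M L (S'' S' : {ffun 'I_P.+1 -> nat}) :
  (Q S'' < Q S')%N -> T_entry R M L S'' S' = 0.
Proof.
rewrite ltnNge => /negP nle; rewrite /T_entry.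
by case: (boolP (phi _ _ _)) => [/Q_phi_le //|_]; rewrite !mul0r.
Qed.

(** If [S ord_max] were [M], every tail sum would be squeezed between [M] and [M], as for the
    goal. *)
Lemma state_max_lt P M (S : {ffun 'I_P.+1 -> nat}) :
  is_state M S -> S <> goal_state P M -> (S ord_max < M)%N.
Proof.
move=> SM Sgoal; have SP : upper S P = S ord_max.
  by rewrite (upperS S ord_max) upper_out // addn0.
rewrite ltn_neqAle -{2}SP upper_le // andbT; apply/eqP => SPM; apply: Sgoal.
apply: (state_ext SM (goal_is_state P M)) => k ltkP; rewrite upper_goal //.
by apply/eqP; rewrite eqn_leq upper_le // -{1}SPM -SP upper_anti.
Qed.

Lemma ltn_bin2l m n k : (m < n)%N -> (0 < k <= n)%N -> ('C(m, k) < 'C(n, k))%N.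
Proof.
case: n => // n; case: k => // k; rewrite !ltnS => lemn lekn.
rewrite binS -addn1 leq_add ?leq_bin2l // bin_gt0 //.
Qed.

Lemma T_entry_diag (R : realType) P M L (S : {ffun 'I_P.+1 -> nat}) :
  T_entry R M L S S = (phi L S S)%:R * 'C(M, L)%:R^-1 * 'C(S ord_max, L)%:R.
Proof.
rewrite /T_entry; congr (_ * _); rewrite big_ord_recr /= big1 ?mul1r.
  by rewrite /W ltnn big1 ?subr0 // => j _; rewrite subrr mulr0.
by move=> k _; rewrite W_upper //= subrr bin0.
Qed.

(** The state stays put only if the lot falls within the labels owned by everybody. There are fewer
    than [M] of these, and [0 < L <= M] makes the binomial inequality strict. *)
Lemma T_entry_diag_lt1 (R : realType) P M L (S : {ffun 'I_P.+1 -> nat}) :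
    (0 < L <= M)%N -> is_state M S -> S <> goal_state P M ->
  T_entry R M L S S < 1.
Proof.
move=> LM SM Sgoal; rewrite T_entry_diag.
have lt_bin := ltn_bin2l (state_max_lt SM Sgoal) LM.
case: (phi L S S); last by rewrite !mul0r ltr01.
by rewrite mul1r mulrC ltr_pdivrMr ?mul1r ?ltr_nat // ltr0n; apply: leq_ltn_trans lt_bin.
Qed.


(** A set is determined by its traces on the fibers of [f], which can be chosen independently. This
    is the numerator of the multivariate hypergeometric law. *)
Lemma card_by_fibers (T : finType) n (f : T -> 'I_n) (w : 'I_n -> nat) :
  #|[set A : {set T} | [forall k, #|A :&: [set c | f c == k]| == w k]]%SET|
  = (\prod_k 'C(#|[set c | f c == k]%SET|, w k))%N.
Proof.
pose fib k := [set c | f c == k]%SET.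
pose F k := [set B : {set T} | (B \subset fib k) && (#|B| == w k)]%SET.
pose h (A : {set T}) := [ffun k => A :&: fib k]%SET.
under eq_bigr => k _ do rewrite -cards_draws -/(fib k) -/(F k).
have -> : (\prod_k #|F k|)%N = #|(family F : simpl_pred {ffun 'I_n -> {set T}})|.
  by rewrite card_family foldrE big_map big_enum.
have h_inj : injective h.
  move=> A B /ffunP hAB; apply/setP => c.
  by have /setP/(_ c) := hAB (f c); rewrite !ffunE !inE eqxx !andbT.
rewrite -(card_imset _ h_inj); apply: eq_card => g.
apply/imsetP/familyP => [[A + ->] k|gF].
  by rewrite inE => /forallP/(_ k) Ak; rewrite ffunE inE subsetIr.
(* The preimage glues the prescribed traces: each [c] is tested in the piece of its own fiber. *)
exists [set c | c \in g (f c)]%SET; last first.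
  apply/ffunP => k; rewrite ffunE; apply/setP => c; rewrite !inE.
  have := gF k; rewrite inE => /andP[/fintype.subsetP/(_ c) + _].
  rewrite inE; case: eqP => [->|_] /=; first by rewrite andbT.
  by rewrite andbF; case: (c \in g k) => // /(_ isT).
rewrite inE; apply/forallP => k.
have := gF k; rewrite inE => /andP[/fintype.subsetP gk /eqP <-].
apply/eqP/eq_card => c; rewrite !inE.
have := gk c; rewrite inE.
case: eqP => [->|_] /=; first by rewrite andbT.
by rewrite andbF; case: (c \in g k) => // /(_ isT).
Qed.

(** * One burst *)

Definition owners P M (G : holdings P M) (c : 'I_M) : nat :=
  #|[set q | c \in G q]%SET|.

(** Projection of the holdings onto the state [S] of the game, forgetting who owns what. *)
Definition ownership P M (G : holdings P M) : {ffun 'I_P.+1 -> nat} :=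
  [ffun j : 'I_P.+1 => #|[set c | owners G c == j]%SET|].

Lemma owners_le P M (G : holdings P M) c : (owners G c <= P)%N.
Proof. by rewrite -{2}(card_ord P) max_card. Qed.

Lemma owners_eqP P M (G : holdings P M) c :
  owners G c = P -> forall q, c \in G q.
Proof.
move=> oP q.
have : [set q | c \in G q]%SET == [set: 'I_P]%SET.
  by rewrite eqEcard finset.subsetT cardsT card_ord -{1}oP /=.
by move/eqP/setP/(_ q); rewrite !inE.
Qed.

Lemma upper_ownership P M (G : holdings P M) k :
  upper (ownership G) k = #|[set c | (k <= owners G c)%N]%SET|.
Proof.
rewrite -sum1dep_card.
rewrite (partition_big (fun c => inord (owners G c) : 'I_P.+1) (fun j => k <= j)%N) /=.
  apply: eq_bigr => j lekj; rewrite ffunE -sum1dep_card; apply: eq_bigl => c.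
  rewrite -val_eqE /= inordK ?ltnS ?owners_le //.
  by case: eqP => [->|]; rewrite ?andbF ?lekj.
by move=> c; rewrite inordK ?ltnS ?owners_le.
Qed.

Lemma ownership_state P M (G : holdings P M) : is_state M (ownership G).
Proof. by rewrite /is_state -upper0 upper_ownership cardsE card_ord. Qed.

Lemma ownership_complete P M : ownership (all_complete P M) = goal_state P M.
Proof.
have oP c : owners (all_complete P M) c = P.
  by rewrite /owners; under eq_finset => q do rewrite ffunE inE; rewrite cardsE card_ord.
apply/ffunP => j; rewrite !ffunE -val_eqE /= eq_sym.
under eq_finset => c do rewrite oP.
by case: (P == j); rewrite cardsE ?card_ord ?card0.
Qed.

Lemma ownership_goal P M (G : holdings P M) :
  (0 < P)%N -> ownership G = goal_state P M -> G = all_complete P M.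
Proof.
move=> P0 Ggoal.
have : upper (ownership G) P = upper (ownership (all_complete P M)) P.
  by rewrite ownership_complete Ggoal.
rewrite ownership_complete upper_goal //.
rewrite upper_ownership => cM.
have : [set c | P <= owners G c]%N%SET == [set: 'I_M]%SET.
  by rewrite eqEcard finset.subsetT cardsT card_ord cM /=.
move=> /eqP/setP oP; apply/ffunP => q; rewrite ffunE; apply/setP => c.
rewrite inE owners_eqP //; apply/eqP; rewrite eqn_leq owners_le.
by have := oP c; rewrite !inE.
Qed.

Lemma ownership_none P M : Q (ownership (no_coupons P M)) = 0%N.
Proof.
rewrite Q_combinadic /combinadic big1 // => p _.
rewrite upper_ownership [X in 'C(X + _, _)](_ : _ = 0%N) ?bin_small //.
apply/eqP; rewrite cards_eq0; apply/eqP/setP => c; rewrite !inE.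
rewrite leqNgt /owners; under eq_finset => q do rewrite ffunE inE.
by rewrite cards0 subn_gt0 ltn_ord.
Qed.

Section Burst.
Variables (R : realType) (P M L : nat) (rule : completion_rule).
Implicit Types (G : holdings P M) (lot : {set 'I_M}) (a : 'I_P).

(** The completion rule is inspected only here and in [active_neq0]; everything else about the
    transition is common to both rules. *)
Lemma inactive_complete G q : q \notin active rule G -> G q = [set: 'I_M]%SET.
Proof. by rewrite /active; case: rule; rewrite inE // => /negPn/eqP. Qed.

(** A nonzero law forces the recipient prescribed by the rules, so each label of the lot is
    retained, transferred to one requester, or discarded; the last happens only when all players own
    it. *)
Lemma owners_play G lot a r c :
    burst_law R L rule G (Some (lot, a, r)) != 0 ->
  owners (play G (Some (lot, a, r))) c
  = (owners G c + ((c \in lot) && (owners G c < P)%N))%N.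
Proof.
set G' := play _ _.
rewrite /burst_law; case: ifP => [_|_]; first by rewrite /= eqxx.
rewrite !mulf_eq0 !negb_or => /andP[_] /prodf_neq0/(_ c isT).
have gain q0 : c \notin G q0 ->
    (forall q, (c \in G' q) = (c \in G q) || (q == q0)) ->
    owners G' c = (owners G c + (owners G c < P))%N.
  move=> nGq0 playq.
  have -> : owners G' c = (owners G c).+1.
    rewrite /owners.
    have -> : [set q | c \in G' q]%SET = (q0 |: [set q | c \in G q])%SET.
      by apply/setP => q; rewrite !inE playq orbC.
    by rewrite cardsU1 inE nGq0.
  rewrite ltn_neqAle owners_le andbT.
  case: eqP => [/owners_eqP/(_ q0)|_]; first by rewrite (negbTE nGq0).
  by rewrite addn1.
have keep : (forall q, (c \in G' q) = (c \in G q)) ->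
    owners (G') c = owners G c.
  by move=> playq; rewrite /owners; under eq_finset => q do rewrite playq.
rewrite /recipient_law inE.
(* Label outside the lot: nothing changes. *)
case clot: (c \in lot) => /=; last first.
  case: (r c =P None) => [rc _|]; last by rewrite /= eqxx.
  rewrite addn0; apply: keep => q.
  by rewrite ffunE !inE rc orbF; case: eqP; rewrite ?inE ?clot orbF.
(* If [a] misses the label, she retains the coupon and is the new owner. *)
case cGa: (c \in G a) => /=; last first.
  case: (r c =P None) => [rc _|]; last by rewrite /= eqxx.
  apply: (gain a) => [|q]; first by rewrite cGa.
  by rewrite ffunE !inE rc orbF; case: eqP; rewrite ?inE ?clot.
(* If [a] owns the label and there are requesters, the new owner is the recipient [q0], a requester
   distinct from [a]. *)
case: ifPn => [reqs|/negPn/eqP/setP noreq].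
  case rc: (r c) => [q0|]; last by rewrite eqxx.
  rewrite /unif; case: ifP => [|_]; last by rewrite eqxx.
  rewrite !inE => /and3P[_ q0a nGq0] _; apply: (gain q0) => [//|q].
  rewrite ffunE !inE rc (inj_eq Some_inj) (eq_sym q0).
  by case: (q =P a) => [->|]; rewrite ?cGa // inE orbF.
case: (r c =P None) => [rc _|]; last by rewrite /= eqxx.
(* Without request, active players other than [a] own the label, and inactive players own
   everything. *)
have cG q : c \in G q.
  have := noreq q; rewrite !inE.
  case: (boolP (q \in active rule G)) => [_ /=|/inactive_complete -> _].
    by case: eqP => [->|_ /= /negbFE].
  by rewrite inE.
have -> : owners G c = P.
  by rewrite /owners; under eq_finset => q do rewrite cG; rewrite cardsE card_ord.
rewrite ltnn addn0 /owners; under eq_finset => q.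
  by rewrite ffunE !inE cG; over.
by rewrite cardsE card_ord.
Qed.

(** Owner counts grow by at most one, so a label newly exceeds [k] owners exactly when it is in the
    lot and had [k] of them; [k < P] ensures that it does grow. *)
Lemma upper_play G lot a r k : (k < P)%N ->
    burst_law R L rule G (Some (lot, a, r)) != 0 ->
  upper (ownership (play G (Some (lot, a, r)))) k.+1
  = (upper (ownership G) k.+1 + #|lot :&: [set c | owners G c == k]%SET|)%N.
Proof.
move=> ltkP law; rewrite !upper_ownership.
under eq_finset => c do rewrite owners_play //.
rewrite -cardsUI.
have -> : ([set c | (k < owners G c)%N]
            :&: (lot :&: [set c | owners G c == k]) = finset.set0)%SET.
  by apply/setP => c; rewrite !inE; case: ltngtP; rewrite ?andbF.
rewrite cards0 addn0.
apply: eq_card => c; rewrite !inE.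
case: (c \in lot) => /=; last by rewrite addn0 orbF.
by case: (ltngtP k (owners G c)) => [ltk|gtk|<-] /=; lia.
Qed.

End Burst.

(** * Transition probabilities of the ownership state *)

Section Transition.
Variables (R : realType) (P M L : nat) (rule : completion_rule).
Implicit Types (G : holdings P M) (lot : {set 'I_M}) (a : 'I_P).

Lemma sum_unif (A : finType) (X : {set A}) :
  X != finset.set0 -> \sum_x unif R X x = 1.
Proof.
move=> X0; rewrite /unif -big_mkcond /= sumr_const -[LHS]mulr_natl mulfV //.
by rewrite pnatr_eq0 cards_eq0.
Qed.

Lemma sum_recipient_law G lot a c : \sum_r recipient_law R rule G lot a c r = 1.
Proof.
rewrite /recipient_law.
case: (boolP ((c \in offered G lot a) && _)) => [/andP[_ req]|_]; last first.
  by rewrite (bigD1 None) //= big1 ?addr0 // => r /negbTE ->.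
rewrite (bigD1 None) //= add0r -[RHS](sum_unif req).
rewrite (reindex_omap Some id) /=; last by case.
by apply: eq_big => [q|//]; rewrite !eqxx.
Qed.

Lemma active_neq0 G : G != all_complete P M -> active rule G != finset.set0.
Proof.
move=> Gnc; have [q Gq] : exists q, G q != [set: 'I_M]%SET.
  apply/existsP; apply: contraNT Gnc; rewrite negb_exists => /forallP Gall.
  by apply/eqP/ffunP => q; rewrite ffunE; apply/eqP; rewrite -[_ == _]negbK Gall.
by apply/set0Pn; exists q; rewrite /active; case: rule; rewrite inE.
Qed.

Let fiber G (k : nat) : {set 'I_M} := [set c | owners G c == k]%SET.

Lemma sum_fibers G lot :
  (\sum_(k < P.+1) #|lot :&: fiber G k|)%N = #|lot|.
Proof.
rewrite -sum1_card (partition_big (fun c => inord (owners G c) : 'I_P.+1) xpredT) //=.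
apply: eq_bigr => k _; rewrite -sum1_card; apply: eq_bigl => c.
by rewrite !inE -val_eqE /= inordK ?ltnS ?owners_le.
Qed.

(** The event of moving to [S''], expressed through the lot alone. *)
Let hits G (S'' : {ffun 'I_P.+1 -> nat}) lot :=
  [forall k : 'I_P, upper (ownership G) k.+1 + #|lot :&: fiber G k|
                    == upper S'' k.+1]%N.

Lemma hits_W G S'' lot :
  ((#|lot| == L) && hits G S'' lot)
  = [forall k : 'I_P.+1, (#|lot :&: fiber G k|)%:Z == W L S'' (ownership G) k].
Proof.
have W_widen (k : 'I_P) :
    ((#|lot :&: fiber G k|)%:Z == W L S'' (ownership G) (widen_ord (leqnSn P) k))
  = (upper (ownership G) k.+1 + #|lot :&: fiber G k| == upper S'' k.+1)%N.
  by rewrite W_upper //=; apply/eqP/eqP; lia.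
have := sum_fibers G lot; rewrite big_ord_recr /= => sumL.
(* Since the [W] sum to [L] and the traces sum to the size of the lot, the equation at [P] amounts
   to the size condition once the others hold. *)
have Wlast : (forall k : 'I_P, (#|lot :&: fiber G k|)%:Z
      = W L S'' (ownership G) (widen_ord (leqnSn P) k)) ->
    ((#|lot :&: fiber G P|)%:Z == W L S'' (ownership G) ord_max) = (#|lot| == L).
  move=> Wk; rewrite W_last; under eq_bigr => k _ do rewrite -Wk.
  rewrite -(big_morph Posz PoszD (erefl _)); set s := (\sum_(i < P) _)%N.
  have : (s + #|lot :&: fiber G P| = #|lot|)%N by exact: sumL.
  by move=> {}sumL; apply/eqP/eqP; lia.
apply/andP/forallP => [[/eqP lotL /forallP hitsk] k|Wk].
  have [ltkP|gekP] := ltnP k P.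
    have -> : k = widen_ord (leqnSn P) (Ordinal ltkP) by apply: val_inj.
    by rewrite W_widen; apply: hitsk.
  have -> : k = ord_max by apply: val_inj; apply/eqP; rewrite eqn_leq gekP -ltnS ltn_ord.
  by rewrite Wlast ?lotL // => j; apply/eqP; rewrite W_widen.
have Wk' (k : 'I_P) : (#|lot :&: fiber G k|)%:Z
    = W L S'' (ownership G) (widen_ord (leqnSn P) k).
  by apply/eqP; apply: Wk.
split; first by rewrite -Wlast //; apply: (Wk ord_max).
by apply/forallP => k; rewrite -W_widen Wk'.
Qed.

Lemma card_hits G S'' :
  #|[set lot : {set 'I_M} | (#|lot| == L) && hits G S'' lot]%SET|
  = (phi L S'' (ownership G)
     * \prod_k 'C(ownership G k, `|W L S'' (ownership G) k|))%N.
Proof.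
(* Traces of an actual lot satisfy the bounds in [phi], so no lot qualifies when [phi] fails; when
   it holds, the absolute values are harmless. *)
case: (boolP (phi _ _ _)) => [/forallP phiW|/negP nphi]; last first.
  rewrite mul0n; apply: eq_card0 => lot; rewrite inE; apply/negP => hit.
  apply: nphi; apply/forallP => k.
  have /andP[/eqP lotL _] := hit; move: hit; rewrite hits_W => /forallP/(_ k)/eqP <-.
  rewrite lez_nat -lotL leq_min subset_leq_card ?subsetIl //=.
  by rewrite ffunE subset_leq_card ?subsetIr.
rewrite mul1n; pose f c : 'I_P.+1 := inord (owners G c).
have fE k : [set c | f c == k]%SET = fiber G k.
  by apply/setP => c; rewrite !inE -val_eqE /= inordK ?ltnS ?owners_le.
under [RHS]eq_bigr => k _ do rewrite ffunE -/(fiber G k) -fE.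
rewrite -card_by_fibers; apply: eq_card => lot; rewrite !inE hits_W.
apply: eq_forallb => k; rewrite fE -eqz_nat gez0_abs //.
by have /andP[] := phiW k.
Qed.

Lemma transition G S'' : G != all_complete P M -> is_state M S'' ->
  \sum_(ob | ownership (play G ob) == S'') burst_law R L rule G ob
  = T_entry R M L S'' (ownership G).
Proof.
move=> Gnc S''M.
rewrite big_mkcond (bigD1 None) //= {1}/burst_law (negbTE Gnc) if_same add0r.
rewrite (reindex_omap Some id) /=; last by case.
under eq_bigl => ob do rewrite !eqxx.
(* The target state depends on the lot only, so the recipients and the assigned player sum out to
   1. *)
transitivity (\sum_lot (if hits G S'' lot then
    unif R [set A : {set 'I_M} | #|A| == L]%SET lot else 0)).
  rewrite (eq_bigr (fun t : burst P M => (if hits G S'' t.1.1 then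
    unif R [set A : {set 'I_M} | #|A| == L]%SET t.1.1 else 0) *
    (unif R (active rule G) t.1.2 *
     \prod_c recipient_law R rule G t.1.1 t.1.2 c (t.2 c)))); last first.
    move=> [[lot a] r] _ /=.
    (* An impossible burst may lead to a state that its lot does not predict, but both summands are
       then 0. *)
    case: (eqVneq (burst_law R L rule G (Some (lot, a, r))) 0) => [law0|law].
      rewrite law0 if_same; move: law0; rewrite /burst_law (negbTE Gnc) -mulrA.
      by case: ifP => _ law0; rewrite ?law0 ?mul0r.
    have -> : (ownership (play G (Some (lot, a, r))) == S'') = hits G S'' lot.
      apply/eqP/forallP => [<- k|hitk]; first by rewrite (upper_play _ law).
      apply: (state_ext (ownership_state _) S''M) => k ltkP.
      by rewrite (upper_play ltkP law); apply/eqP; apply: (hitk (Ordinal ltkP)).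
    rewrite /burst_law (negbTE Gnc) -mulrA.
    by case: ifP => //; rewrite mul0r.
  rewrite -(pair_bigA _ (fun (la : {set 'I_M} * 'I_P)
      (r : {ffun 'I_M -> option 'I_P}) => (if hits G S'' la.1 then
    unif R [set A : {set 'I_M} | #|A| == L]%SET la.1 else 0) *
    (unif R (active rule G) la.2 *
     \prod_c recipient_law R rule G la.1 la.2 c (r c)))) /=.
  rewrite -(pair_bigA _ (fun lot a =>
    \sum_(r : {ffun 'I_M -> option 'I_P}) (if hits G S'' lot then
    unif R [set A : {set 'I_M} | #|A| == L]%SET lot else 0) *
    (unif R (active rule G) a *
     \prod_c recipient_law R rule G lot a c (r c)))) /=.
  apply: eq_bigr => lot _.
  have rec1 a : \sum_(r : {ffun 'I_M -> option 'I_P})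
      \prod_c recipient_law R rule G lot a c (r c) = 1.
    rewrite -(bigA_distr_bigA (recipient_law R rule G lot a)) big1 // => c _.
    exact: sum_recipient_law.
  under eq_bigr => a _ do rewrite -!mulr_sumr rec1 mulr1.
  rewrite -mulr_sumr.
  by rewrite sum_unif ?mulr1 // active_neq0.
rewrite -big_mkcond /unif -big_mkcondr /= sumr_const card_draws card_ord.
rewrite /T_entry mulrAC -natr_prod -natrM -card_hits -[LHS]mulr_natl; congr (_%:R * _).
by apply: eq_card => lot; rewrite [LHS]unfold_in /= !inE andbC.
Qed.

End Transition.

(** * Occupation numbers of a triangular chain *)

Lemma cvgn_sum (R : realType) (I : Type) (r : seq I) (P : pred I)
    (u : I -> nat -> R) (l : I -> R) :
  (forall i, (u i n @[n --> \oo] --> l i)%classic) ->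
  (\sum_(i <- r | P i) u i n @[n --> \oo] --> \sum_(i <- r | P i) l i)%classic.
Proof.
move=> ul; elim: r => [|i r IHr].
  by under eq_fun => n do rewrite big_nil; rewrite big_nil; apply: cvg_cst.
under eq_fun => n do rewrite big_cons; rewrite big_cons.
by case: (P i) => //; apply: cvgD.
Qed.

Section Occupation.
Variables (R : realType) (n : nat) (T : 'M[R]_n) (b tau : 'I_n -> R).
Variable p : nat -> 'I_n -> R.
Hypothesis T_ge0 : forall j k, 0 <= T j k.
Hypothesis T_lower : forall j k : 'I_n, (j < k)%N -> T j k = 0.
Hypothesis T_diag : forall j, T j j < 1.
Hypothesis p_ge0 : forall m j, 0 <= p m j.
Hypothesis p0 : forall j, p 0 j = b j.
Hypothesis pS : forall m j, p m.+1 j = \sum_k T j k * p m k.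
Hypothesis tauE : forall j,
  tau j * (1 - T j j) = b j + \sum_(k < n | (k < j)%N) T j k * tau k.

Let split_diag (x : 'I_n -> R) j :
  \sum_k T j k * x k = T j j * x j + \sum_(k < n | (k < j)%N) T j k * x k.
Proof.
rewrite (bigD1 j) //=; congr (_ + _); rewrite big_mkcond [RHS]big_mkcond /=.
apply: eq_bigr => k _; rewrite -val_eqE /=.
by case: ltngtP => // ltjk; rewrite T_lower // mul0r.
Qed.

(** When [p m] is the law of the chain after [m] steps, this is the expected number of visits to [j]
    during the first [m] steps. *)
Let s m j := \sum_(i < m) p i j.

Let sS m j : s m.+1 j = b j + \sum_k T j k * s m k.
Proof.
rewrite /s big_ord_recl /= p0; congr (_ + _).
under [RHS]eq_bigr => k _ do rewrite mulr_sumr.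
by rewrite exchange_big; apply: eq_bigr => i _; rewrite pS.
Qed.

Let s_mono j : {homo s^~ j : m q / (m <= q)%N >-> m <= q}.
Proof.
apply: homo_leq => [x|x y z|m]; [exact: lexx|exact: le_trans|].
by rewrite /s big_ord_recr lerDl.
Qed.

(** Induction along the triangular order: [s m j <= s m.+1 j] turns the recursion into an
    inequality, whose terms below [j] are bounded by [tau], and [1 - T j j] is positive. *)
Let s_le m (j : 'I_n) : s m j <= tau j.
Proof.
have [k] := ubnP (j : nat); elim: k j => // k IHk j ltjk.
have : s m j * (1 - T j j) <= tau j * (1 - T j j).
  have := s_mono j (leqnSn m); rewrite sS split_diag tauE.
  have : \sum_(k < n | (k < j)%N) T j k * s m k
      <= \sum_(k < n | (k < j)%N) T j k * tau k.
    apply: ler_sum => i ltij; apply: ler_wpM2l => //.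
    by apply: IHk; apply: leq_trans ltij _.
  by lra.
by rewrite ler_pM2r // subr_gt0.
Qed.

(** Bounded monotone partial sums converge. Their limits solve the same triangular system as [tau],
    whose solution is unique by forward substitution. *)
Lemma occupation_cvg j : (\sum_(i < m) p i j @[m --> \oo] --> tau j)%classic.
Proof.
pose l j := limn (s^~ j).
have s_cvg i : (s m i @[m --> \oo] --> l i)%classic.
  apply: nondecreasing_is_cvgn; first exact: s_mono.
  by exists (tau i) => _ [m _ <-]; apply: s_le.
have lE i : l i = b i + \sum_k T i k * l k.
  have : (s m.+1 i @[m --> \oo] --> l i)%classic by rewrite (cvg_shiftS (s^~ i)).
  move/cvg_lim => <- //; apply: cvg_lim => //.
  under eq_fun => m do rewrite sS.
  apply: cvgD; first exact: cvg_cst.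
  by apply: cvgn_sum => k; apply: cvgM => //; apply: cvg_cst.
suff -> : tau j = l j by apply: s_cvg.
have [k] := ubnP (j : nat); elim: k j => // k IHk j ltjk.
have T1 : 1 - T j j != 0 by rewrite subr_eq0 eq_sym lt_eqF.
apply: (mulIf T1); rewrite tauE {T1}.
have := lE j; rewrite split_diag.
rewrite (eq_bigr (fun i => T j i * tau i)); first by lra.
by move=> i ltij; rewrite IHk //; apply: leq_trans ltij _.
Qed.

End Occupation.

(** * The law of the holdings *)

Section FinitePartition.
Context (R : realType) d (Omega : measurableType d) (Pr : probability Omega R).
Local Open Scope classical_set_scope.

Lemma measurable_fin_pred (F : finType) (X : Omega -> F) (A : pred F) :
  (forall x, measurable [set w | X w = x]) -> measurable [set w | A (X w)].
Proof.
move=> mX.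
rewrite (_ : [set w | A (X w)] = \big[setU/set0]_(x | A x) [set w | X w = x]).
  by apply: bigsetU_measurable => x _; apply: mX.
rewrite -bigcup_seq_cond; apply/seteqP; split=> [w /= Aw|w [x /= /andP[_ Ax] ->]//].
by exists (X w) => //=; rewrite mem_index_enum.
Qed.

Lemma probability_partition (F : finType) (X : Omega -> F) (A : set Omega) :
    measurable A -> (forall x, measurable [set w | X w = x]) ->
  Pr A = (\sum_x Pr (A `&` [set w | X w = x]))%E.
Proof.
move=> mA mX; rewrite fsbig_seq ?index_enum_uniq //.
rewrite -measure_fin_bigcup //.
- congr (Pr _); apply/seteqP; split=> [w Aw|w [x _ []]//].
  by exists (X w) => //=; rewrite mem_index_enum.
- by move=> x y _ _ [w [[_ <-] [_ <-]]].
- by move=> x _; apply: measurableI.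
Qed.

Lemma fine_probability_sum (F : finType) (X : Omega -> F) (A : pred F) :
    (forall x, measurable [set w | X w = x]) ->
  fine (Pr [set w | A (X w)]) = \sum_(x | A x) fine (Pr [set w | X w = x]).
Proof.
move=> mX; rewrite (probability_partition (measurable_fin_pred A mX) mX).
rewrite -sum_fine => [|x _]; last first.
  by apply: fin_num_measure; apply: measurableI => //; apply: measurable_fin_pred.
rewrite [RHS]big_mkcond /=; apply: eq_bigr => x _; case: ifPn => Ax.
  congr (fine (Pr _)); apply/seteqP; split=> [w []//|w /= Xw].
  by split=> //=; rewrite Xw.
rewrite (_ : _ `&` _ = set0) ?measure0 //.
by apply/seteqP; split=> w //= [Aw Xw]; move: Ax; rewrite -Xw Aw.
Qed.

End FinitePartition.

Lemma eq_holdings_after P M (h h' : nat -> option (burst P M)) n :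
  (forall i, (i < n)%N -> h i = h' i) ->
  holdings_after h n = holdings_after h' n.
Proof.
elim: n => //= n IHn hh'; rewrite hh' // IHn // => i ltin.
by apply: hh'; apply: leqW.
Qed.

Lemma play_complete P M (ob : option (burst P M)) :
  play (all_complete P M) ob = all_complete P M.
Proof.
case: ob => [[[lot a] r]|] //=; apply/ffunP => q; rewrite !ffunE.
by apply/setP => c; rewrite !inE.
Qed.

Section Law.
Context (R : realType) (P M L : nat) (rule : completion_rule).
Context d (Omega : measurableType d) (Pr : probability Omega R).
Variable burst_seq : nat -> Omega -> option (burst P M).
Hypothesis game : is_game L rule Pr burst_seq.
Local Open Scope classical_set_scope.

Definition hold n w := holdings_after (fun i => burst_seq i w) n.

(** The history before time [n] as an element of a finite type, so that conditioning on it is a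
    finite sum. *)
Let past n w : {ffun 'I_n -> option (burst P M)} :=
  [ffun i : 'I_n => burst_seq i w].

(** The chain rule of the game speaks of infinite sequences; a finite history is prolonged by the
    constant [ob], which serves as the next burst at position [n]. *)
Let extend n (f : {ffun 'I_n -> option (burst P M)}) ob i :=
  if insub i is Some j then f j else ob.

Let extend_lt n f ob i (ltin : (i < n)%N) : @extend n f ob i = f (Ordinal ltin).
Proof. by rewrite /extend insubT. Qed.

Let extend_n n f ob : @extend n f ob n = ob.
Proof. by rewrite /extend insubF ?ltnn. Qed.

Let past_eq n f ob :
  [set w | past n w = f]
  = [set w | forall i, (i < n)%N -> burst_seq i w = extend f ob i].
Proof.
apply/seteqP; split=> [w <- i ltin|w /= fw].
  by rewrite extend_lt ffunE.
by apply/ffunP => -[i ltin]; rewrite ffunE fw // extend_lt.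
Qed.

Let measurable_past n f : measurable [set w | past n w = f].
Proof.
rewrite (past_eq f None); move: (extend f None) => h; elim: n {f} => [|n IHn].
  by rewrite (_ : mkset _ = setT) //; apply/seteqP; split.
rewrite (_ : mkset _ = [set w | forall i, (i < n)%N -> burst_seq i w = h i]
    `&` [set w | burst_seq n w = h n]).
  by apply: measurableI => //; apply: game.1.
apply/seteqP; split=> [w /= hw|w [/= hw hn] i].
  by split=> [i ltin|]; apply: hw => //; apply: leqW.
by rewrite ltnS leq_eqVlt => /predU1P[->|/hw].
Qed.

Let hold_past n f w :
  past n w = f -> hold n w = holdings_after (extend f None) n.
Proof.
move=> <-; apply: eq_holdings_after => i ltin.
by rewrite extend_lt ffunE.
Qed.

Let past_burst n f ob :
  fine (Pr [set w | (past n w, burst_seq n w) = (f, ob)])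
  = fine (Pr [set w | past n w = f])
    * burst_law R L rule (holdings_after (extend f None) n) ob.
Proof.
have -> : holdings_after (extend f None) n = holdings_after (extend f ob) n.
  by apply: eq_holdings_after => i ltin; rewrite !extend_lt.
have := game.2 n (extend f ob); rewrite extend_n -(past_eq f ob) => /(congr1 fine).
rewrite fineM //; last by apply: fin_num_measure; apply: measurable_past.
move=> <-; congr (fine (Pr _)); apply/seteqP; split=> w /=.
  case=> <- <- i; rewrite ltnS leq_eqVlt => /predU1P[->|ltin].
    by rewrite extend_n.
  by rewrite extend_lt ffunE.
move=> hw; congr (_, _); last by rewrite hw // extend_n.
by apply/ffunP => -[i ltin]; rewrite ffunE hw ?extend_lt //=; apply: leqW.
Qed.

Lemma measurable_hold n G : measurable [set w | hold n w = G].
Proof.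
rewrite (_ : mkset _ =
    [set w | holdings_after (extend (past n w) None) n == G]).
  exact: (measurable_fin_pred
            (fun f => holdings_after (extend f None) n == G) (@measurable_past n)).
by apply/seteqP; split=> w /=; rewrite -(hold_past erefl) => /eqP.
Qed.

(** Markov property of the holdings: the law of the next burst depends on the history only through
    them. *)
Lemma hold_step n (A : pred (holdings P M)) :
  fine (Pr [set w | A (hold n.+1 w)])
  = \sum_G fine (Pr [set w | hold n w = G])
           * \sum_(ob | A (play G ob)) burst_law R L rule G ob.
Proof.
pose H f := holdings_after (@extend n f None) n.
pose X w := (past n w, burst_seq n w).
have mX x : measurable [set w | X w = x].
  case: x => f ob; rewrite (_ : mkset _ =
    [set w | past n w = f] `&` [set w | burst_seq n w = ob]).
    by apply: measurableI => //; apply: game.1.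
  by apply/seteqP; split=> w /= [<- <-].
rewrite (_ : mkset _ = [set w | A (play (H (X w).1) (X w).2)]); last first.
  by apply/seteqP; split=> w /=; rewrite /H -(hold_past erefl).
rewrite (fine_probability_sum Pr (fun x => A (play (H x.1) x.2)) mX).
rewrite (eq_bigr (fun x => fine (Pr [set w | past n w = x.1])
    * burst_law R L rule (H x.1) x.2)); last by move=> [f ob] _; exact: past_burst.
rewrite -(pair_big_dep xpredT (fun f ob => A (play (H f) ob)) (fun f ob =>
  fine (Pr [set w | past n w = f]) * burst_law R L rule (H f) ob)) /=.
(* Histories are grouped by the holdings they produce. *)
rewrite (partition_big H xpredT) //=; apply: eq_bigr => G _.
rewrite (_ : mkset _ = [set w | H (past n w) == G]); last first.
  by apply/seteqP; split=> w /=; rewrite /H -(hold_past erefl) => /eqP.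
rewrite (fine_probability_sum Pr (fun f => H f == G) (@measurable_past n)).
rewrite mulr_suml; apply: eq_bigr => f /eqP <-.
by rewrite mulr_sumr.
Qed.

Lemma hold_sum n (A : pred (holdings P M)) :
  fine (Pr [set w | A (hold n w)])
  = \sum_(G | A G) fine (Pr [set w | hold n w = G]).
Proof. exact: (fine_probability_sum Pr A (measurable_hold n)). Qed.

Lemma hold_complete_mono n m w : (n <= m)%N ->
  hold n w = all_complete P M -> hold m w = all_complete P M.
Proof.
move/subnK <-; elim: (m - n)%N => //= k IHk Hn.
by rewrite addSn /hold /= -/(hold _ w) IHk // play_complete.
Qed.

(** * The expected number of bursts as a series of probabilities *)

Let unfinished n : set Omega := [set w | hold n w != all_complete P M].

(** The goal is absorbing, so the game is unfinished exactly at the times before the hitting time,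
    and counting these times gives it, even if infinite. *)
Lemma bursts_to_goal_series w :
  bursts_to_goal R (fun i => burst_seq i w)
  = (\sum_(0 <= n <oo) (\1_(unfinished n) w)%:E)%E.
Proof.
have one_n n : hold n w != all_complete P M -> \1_(unfinished n) w = 1 :> R.
  by move=> Hn; rewrite indicE mem_set.
have zero_n n : hold n w = all_complete P M -> \1_(unfinished n) w = 0 :> R.
  by move=> Hn; rewrite indicE memNset //= /unfinished /= Hn eqxx.
have ge0_n n : (0 <= (\1_(unfinished n) w : R)%:E)%E by rewrite lee_fin indicE ler0n.
rewrite /bursts_to_goal.
have [[n0 Hn0]|never] := pselect (exists n, hold n w == all_complete P M); last first.
  have nH n : hold n w != all_complete P M.
    by apply/negP => Hn; apply: never; exists n.
  rewrite (_ : mkset _ = set0); last first.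
    by apply/seteqP; split=> // n /= Hn; have := nH n; rewrite /hold Hn eqxx.
  rewrite image_set0 ereal_inf0; apply/esym/eqyP => x x0.
  (* If the goal is never reached, the partial sum of length [N] equals [N], which is at least
     [x]. *)
  pose N := `|Num.ceil x|%N.
  apply: (@le_trans _ _ (\sum_(0 <= n < N) (\1_(unfinished n) w)%:E)%E); last first.
    exact: nneseries_lim_ge.
  under eq_bigr => n _ do rewrite one_n //.
  rewrite sumEFin sumr_const_nat subn0 lee_fin.
  apply: le_trans (Num.Theory.ceil_ge x) _.
  by rewrite /N natr_absz ler_int ler_norm.
have ex : exists n, hold n w == all_complete P M by exists n0.
case: (ex_minnP ex) => N /eqP HN Nmin {n0 Hn0 ex}.
(* [N] is the first hitting time: the terms before it are 1, the others 0. *)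
rewrite (nneseries_split 0 N) // add0n eseries0 ?adde0; last first.
  by move=> n leNn _; rewrite zero_n //; apply: hold_complete_mono HN.
rewrite (eq_big_nat _ _ (F2 := fun=> 1%:E)) => [|n /andP[_ ltnN]]; last first.
  by rewrite one_n //; apply: contraTN ltnN => /Nmin; rewrite -leqNgt.
rewrite sumEFin sumr_const_nat subn0.
apply/eqP; rewrite eq_le; apply/andP; split.
  by apply: ereal_inf_lbound; exists N.
apply: le_ereal_inf_tmp => _ [n /= Hn <-].
by rewrite lee_fin ler_nat; apply: Nmin; apply/eqP.
Qed.

Lemma expected_bursts_series :
  expected_bursts Pr burst_seq = (\sum_(0 <= n <oo) Pr (unfinished n))%E.
Proof.
have munf n : measurable (unfinished n).
  exact: (measurable_fin_pred (fun G => G != all_complete P M) (measurable_hold n)).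
rewrite /expected_bursts; under eq_integral => w _ do rewrite bursts_to_goal_series.
rewrite integral_nneseries //.
- by apply: eq_eseriesr => n _; rewrite integral_indic // setIT.
- by move=> n; apply/measurable_EFinP; apply: measurable_indic.
Qed.

End Law.

(** * Identification of the occupation numbers with [tau] *)

Theorem theorem7 (R : realType) (P M L : nat)
    (hP : (1 <= P)%N) (hM : (1 <= M)%N) (hL : (1 <= L <= M)%N)
    (rule : completion_rule)
    (d : measure_display) (Omega : measurableType d) (Pr : probability Omega R)
    (burst_seq : nat -> Omega -> option (burst P M))
    (hgame : is_game L rule Pr burst_seq)
    (T : 'M[R]_(mu P M%:Z - 1))
    (hT : forall S'' S' : {ffun 'I_P.+1 -> nat},
        is_state M S'' -> S'' <> goal_state P M ->
        is_state M S' -> S' <> goal_state P M ->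
        forall i j : 'I_(mu P M%:Z - 1),
          i = Q S'' :> nat -> j = Q S' :> nat ->
          T i j = T_entry R M L S'' S')
    (tau : 'I_(mu P M%:Z - 1) -> R)
    (htau0 : forall j : 'I_(mu P M%:Z - 1), j = 0%N :> nat -> tau j = 1)
    (htau : forall j : 'I_(mu P M%:Z - 1), (1 <= j)%N ->
        tau j = 1 / (1 - T j j)
                * \sum_(k < mu P M%:Z - 1 | (k < j)%N) T j k * tau k) :
  expected_bursts Pr burst_seq = (\sum_(j < mu P M%:Z - 1) tau j)%:E.

Proof.
set N := (mu P M%:Z - 1)%N in T hT tau htau0 htau *.
(* The goal gets index [N], just outside ['I_N], so summing over ['I_N] restricts to unfinished
   games. *)
pose idx (G : holdings P M) := Q (ownership G).
pose p m (k : 'I_N) := fine (Pr [set w | idx (hold burst_seq m w) == k]%classic).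
have idx_complete G : (N <= idx G)%N -> G = all_complete P M.
  move=> leN; apply: (ownership_goal hP); apply: contrapT => Ggoal.
  by move: leN; rewrite leqNgt Q_lt //; apply: ownership_state.
have idx_lt G : G != all_complete P M -> (idx G < N)%N.
  by rewrite ltnNge; apply: contraNN => /idx_complete ->.
have idx_goal : idx (all_complete P M) = N by rewrite /idx ownership_complete Q_goal.
(* Surjectivity of [Q] makes every entry of [T] a [T_entry], so the properties of the latter carry
   over. *)
have T_state (j k : 'I_N) : exists S'' S',
    [/\ is_state M S'', S'' <> goal_state P M,
    is_state M S' & S' <> goal_state P M]
    /\ [/\ Q S'' = j, Q S' = k & T j k = T_entry R M L S'' S'].
  have [S'' [S''M S''g QS'']] := Q_surj (ltn_ord j).
  have [S' [S'M S'g QS']] := Q_surj (ltn_ord k).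
  by exists S'', S'; split; split=> //; apply: hT.
have T_ge0 j k : 0 <= T j k.
  by have [S'' [S' [_ [_ _ ->]]]] := T_state j k; apply: T_entry_ge0.
have T_lower (j k : 'I_N) : (j < k)%N -> T j k = 0.
  have [S'' [S' [_ [<- <- ->]]]] := T_state j k; exact: T_entry_lower.
have T_diag j : T j j < 1.
  have [S'' [S' [[S''M S''g S'M _] [QS'' QS' ->]]]] := T_state j j.
  by rewrite (Q_inj S'M S''M) ?QS' ?QS'' ?T_entry_diag_lt1.
(* Index 0 is the initial state, where no label is owned by all [P >= 1] players: a lot of [L >= 1]
   coupons always changes it. This makes [tau] equal to 1 there consistent with the linear
   system. *)
have T00 (j : 'I_N) : j = 0%N :> nat -> T j j = 0.
  move=> j0; have [S'' [S' [[S''M S''g S'M _] [QS'' QS' ->]]]] := T_state j j.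
  have S0M := ownership_state (no_coupons P M).
  rewrite (Q_inj S'M S''M) ?QS' ?QS'' // T_entry_diag.
  rewrite (Q_inj S''M S0M) ?ownership_none ?QS'' //.
  have -> : ownership (no_coupons P M) ord_max = 0%N.
    rewrite ffunE; apply/eqP; rewrite cards_eq0; apply/eqP/setP => c.
    rewrite !inE /owners; under eq_finset => q do rewrite ffunE inE.
    by rewrite cards0 /= eq_sym -leqn0 leqNgt hP.
  by case/andP: hL => L0 _; rewrite (@bin_small 0) // mulr0.
have pS m j : p m.+1 j = \sum_k T j k * p m k.
  rewrite /p (hold_step hgame m (fun G => idx G == j)).
  under [RHS]eq_bigr => k _ do
    rewrite (hold_sum hgame m (fun G => idx G == k)) big_mkcond mulr_sumr.
  rewrite exchange_big; apply: eq_bigr => G _.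
  (* Complete holdings contribute 0 on both sides; otherwise only the column [idx G] survives. *)
  have [->|Gnc] := eqVneq G (all_complete P M).
    rewrite big1 ?mulr0 => [|ob]; last first.
      by rewrite play_complete idx_goal => /eqP Nj; have := ltn_ord j; rewrite -Nj ltnn.
    rewrite big1 // => k _; case: ifP => [|_]; last by rewrite mulr0.
    by rewrite idx_goal => /eqP Nk; have := ltn_ord k; rewrite -Nk ltnn.
  rewrite (bigD1 (Ordinal (idx_lt G Gnc))) //= eqxx [X in _ = _ + X]big1 ?addr0; last first.
    move=> k /eqP nk; case: ifP => [/eqP Gk|_]; last by rewrite mulr0.
    by case: nk; apply: val_inj.
  have [S'' [S''M S''g QS'']] := Q_surj (ltn_ord j).
  rewrite mulrC; congr (_ * _).
  rewrite (hT S'' (ownership G)) //; first last.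
  - by move=> Gg; have := idx_lt G Gnc; rewrite /idx Gg Q_goal ltnn.
  - exact: ownership_state.
  rewrite -(transition R L rule Gnc S''M); apply: eq_bigl => ob.
  apply/eqP/eqP => [idxj|oS]; last by rewrite /idx oS.
  by apply: (Q_inj (ownership_state _) S''M); rewrite QS''.
have p0 j : p 0 j = (j == 0%N :> nat)%:R.
  rewrite /p /hold /= /idx ownership_none eq_sym; case: (_ == _).
    by rewrite (_ : mkset _ = setT) ?probability_setT //; apply/seteqP; split.
  by rewrite (_ : mkset _ = set0) ?measure0 //; apply/seteqP; split.
have p_ge0 m j : 0 <= p m j by apply: fine_ge0; apply: measure_ge0.
(* The recurrence is forward substitution for [(I - T) tau = e_0], with [e_0] the law of the initial
   state. *)
have tauE (j : 'I_N) : tau j * (1 - T j j)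
    = (j == 0%N :> nat)%:R + \sum_(k < N | (k < j)%N) T j k * tau k.
  have [j0|j_gt0] := posnP (j : nat).
    rewrite htau0 // T00 // subr0 mulr1 big1 ?addr0 // => k.
    by rewrite j0.
  rewrite htau //= add0r mulrAC mul1r mulVf ?mul1r //.
  by rewrite subr_eq0 eq_sym lt_eqF.
have cvg_p := occupation_cvg T_ge0 T_lower T_diag p_ge0 p0 pS tauE.
rewrite (expected_bursts_series hgame).
apply/cvg_lim => //.
(* The partial sums of the series are rewritten as finite sums of partial occupation numbers: being
   unfinished after [i] bursts means having some index in ['I_N]. *)
apply: (@cvg_trans _
  ((\sum_(j < N) \sum_(i < m) p i j)%:E @[m --> \oo])%classic); last first.
  by apply: cvg_EFin; [exact: nearW|apply: cvgn_sum].
apply: near_eq_cvg; apply: nearW => m.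
rewrite exchange_big big_mkord -sumEFin; apply: eq_bigr => i _.
rewrite -[RHS]fineK; last first.
  apply: fin_num_measure.
  exact: (measurable_fin_pred (fun G => G != all_complete P M)
            (measurable_hold hgame i)).
congr (_%:E); rewrite (hold_sum hgame i (fun G => G != all_complete P M)).
under eq_bigr => j _ do
  rewrite /p (hold_sum hgame i (fun G => idx G == j)) big_mkcond.
rewrite exchange_big [RHS]big_mkcond; apply: eq_bigr => G _.
case: ifPn => [Gnc|/negPn/eqP ->].
  rewrite (bigD1 (Ordinal (idx_lt G Gnc))) //= eqxx big1 ?addr0 // => k /eqP nk.
  by case: ifP => // /eqP Gk; case: nk; apply: val_inj.
rewrite big1 // => k _; case: ifP => //.
by rewrite idx_goal => /eqP Nk; have := ltn_ord k; rewrite -Nk ltnn.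
Qed.
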